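(* Let $s\ge 1$ and $k\ge 2$ be integers, and let $T$ be a tree in which one vertex has degree $k$ and every other vertex has degree at most $\lceil k/2\rceil$. Then $$br_{\Delta}(T;s)=s(k-1)+1.$$
   Context: For graphs $H$ and $G$ and a positive integer $s$, write $H\xrightarrow{s} G$ if every coloring of the edges of $H$ with $s$ colors contains a monochromatic subgraph isomorphic to $G$. The degree bipartite Ramsey number is $br_{\Delta}(G;s)=\min\{\Delta(H): H \text{ is bipartite and } H\xrightarrow{s} G\}$, where $\Delta(H)$ denotes the maximum degree of $H$. *)

(* Defs.v *)
From mathcomp Require Import all_boot.
Set Implicit Arguments. Unset Strict Implicit. Unset Printing Implicit Defensive.

Definition simple_graph (V : finType) (E : rel V) : Prop :=
  symmetric E /\ irreflexive E.

Definition deg (V : finType) (E : rel V) (x : V) : nat := #|[set y | E x y]|.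

Definition maxdeg (V : finType) (E : rel V) : nat := \max_(x : V) deg E x.

Definition is_tree (V : finType) (E : rel V) : Prop :=
  0 < #|V| /\
  (forall x y : V, connect E x y) /\
  (forall s : seq V, 3 <= size s -> uniq s -> ~~ cycle E s).

Definition bipartite (V : finType) (E : rel V) : Prop :=
  exists part : V -> bool, forall x y, E x y -> part x != part y.

(* H --s--> G : every s-colouring of the edges of H has a monochromatic
   subgraph isomorphic to G (i.e. an injective edge-preserving map of G into
   H all of whose image edges get the same colour). An edge colouring is a
   symmetric function on pairs of vertices (only values on edges matter). *)
Definition arrows (VH : finType) (EH : rel VH) (s : nat)
    (VG : finType) (EG : rel VG) : Prop :=
  forall c : VH -> VH -> 'I_s, (forall x y, c x y = c y x) ->
  exists (i : 'I_s) (f : VG -> VH), injective f /\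
    forall u v, EG u v -> EH (f u) (f v) /\ c (f u) (f v) = i.

Definition is_brDelta (VG : finType) (EG : rel VG) (s n : nat) : Prop :=
  (exists (VH : finType) (EH : rel VH),
      simple_graph EH /\ bipartite EH /\ arrows EH s EG /\ maxdeg EH = n) /\
  (forall (VH : finType) (EH : rel VH),
      simple_graph EH -> bipartite EH -> arrows EH s EG -> n <= maxdeg EH).

(* Main.v *)
Require Import Defs.
From mathcomp Require Import all_boot all_fingroup zify.
Set Implicit Arguments. Unset Strict Implicit. Unset Printing Implicit Defensive.

(** Lower bound: a bipartite graph of maximum degree at most s(k-1) has a proper
    edge colouring with s(k-1) colours (König); merging the colours in groups of
    k-1 leaves no monochromatic vertex of degree k.

    Upper bound: let H be a bipartite d-regular graph, d = s(k-1)+1, of girth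
    larger than |T|.  It is the bipartite double cover of the Cayley graph
    generated by d involutions acting on the reduced words of length at most |T|,
    where the i-th involution adds or removes a leading letter i.  In any
    s-colouring some colour class has average degree above k-1; a minimal vertex
    set with this density has minimum degree at least k/2 and contains a vertex
    of degree at least k, from which T is embedded greedily.  The girth condition
    prevents the embedded part from closing up. *)

(** * Kempe chains in bipartite graphs *)

Definition proper (V : finType) (C : eqType) (E : rel V) (col : V -> V -> C) : Prop :=
  forall x y z, E x y -> E x z -> col x y = col x z -> y = z.

Lemma missing_color (V C : finType) (E : rel V) (col : V -> V -> C) (x : V) :
  deg E x < #|C| -> exists a, forall y, E x y -> col x y != a.
Proof.
move=> ltdC; pose used := [set col x y | y in [set y | E x y]].
have /subsetPn[a _ aN] : ~~ ([set: C] \subset used).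
  apply: contraTN ltdC => /subset_leq_card; rewrite cardsT -leqNgt => /leq_trans; apply.
  exact: leq_imset_card.
exists a => y Exy; apply: contraNneq aN => <-.
by apply: imset_f; rewrite inE.
Qed.

Section Kempe.
Variables (V : finType) (C : eqType) (E : rel V) (part : V -> bool).
Variables (col : V -> V -> C) (u v : V) (a b : C).
Hypotheses (symE : symmetric E) (bipE : forall x y, E x y -> part x != part y).
Hypotheses (symcol : forall x y, col x y = col y x) (pcol : proper E col).
Hypotheses (puv : part u != part v).
Hypotheses (ua : forall y, E u y -> col u y != a) (vb : forall y, E v y -> col v y != b).

(* Orienting [a]-edges away from the side of [v] and [b]-edges towards it makes
   every in-degree at most one, and zero at [u] and at [v]. *)
Let arc x y := E x y && (col x y == if part x == part v then a else b).
Let chain := connect arc v.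

Let arc_inj x x' y : arc x y -> arc x' y -> x = x'.
Proof.
case/andP=> Exy /eqP cxy /andP[Exy' /eqP cxy'].
have px := bipE Exy; have px' := bipE Exy'.
have pxx' : part x = part x' by case: (part x) (part x') (part y) px px' => [] [] [].
apply: (pcol (x := y)); rewrite 1?symE // symcol cxy [RHS]symcol cxy'.
by rewrite pxx'.
Qed.

Let arc_source x : ~~ arc x v.
Proof.
apply/negP => /andP[Exv /eqP]; rewrite (negPf (bipE Exv)) symcol => /eqP.
by apply/negP/vb; rewrite symE.
Qed.

(** An arc into [u] would start on the side of [v], hence have colour [a], which is missing at
    [u]. *)
Let chainNu : ~~ chain u.
Proof.
apply/negP => /connectP[p]; case/lastP: p => [|p y] /=.
  by move=> _ uv; move: puv; rewrite uv eqxx.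
rewrite rcons_path last_rcons => /andP[_ /andP[+ +]] uy; rewrite -uy => Eyu /eqP cyu.
have pl : part (last v p) == part v.
  by move: puv (bipE Eyu); case: (part u) (part v) (part (last v p)) => [] [] [].
by move: cyu; rewrite pl symcol => /eqP; apply/negP/ua; rewrite symE.
Qed.

Let chain_back x y : arc x y -> chain y -> chain x.
Proof.
move=> axy /connectP[p]; case/lastP: p => [|p z] /=.
  by move=> _ yv; move: axy; rewrite yv (negPf (arc_source x)).
rewrite rcons_path last_rcons => /andP[pp alz] yz; subst z.
by rewrite (arc_inj axy alz); apply/connectP; exists p.
Qed.

(** In-degree at most one makes [chain] closed under predecessors as well, so no edge coloured [a]
    or [b] leaves it. *)
Let chain_edge x y : E x y -> (col x y == a) || (col x y == b) -> chain x = chain y.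
Proof.
move=> Exy cab; have pxy := bipE Exy.
have [axy|ayx] : arc x y \/ arc y x.
  rewrite /arc [E y x]symE Exy (symcol y x) /=.
  move: pxy cab; case: (part x) (part y) (part v) => [] [] [] //= _ /orP[] ->; by [left|right].
- by apply/idP/idP => [/connect_trans|]; [apply; exact: connect1 | exact: chain_back].
- by apply/idP/idP => [|/connect_trans]; [exact: chain_back | apply; exact: connect1].
Qed.

Let swap c := if c == a then b else if c == b then a else c.
Let swap_inj : injective swap.
Proof.
have swapK : involutive swap.
  move=> c; rewrite /swap; case: (eqVneq c a) => [->|ca].
    by case: (eqVneq b a) => [->|]; rewrite ?eqxx.
  by case: (eqVneq c b) => [->|cb]; rewrite ?eqxx ?(negPf ca) ?(negPf cb).
exact: inv_inj.
Qed.

(** Swapping [a] and [b] on the chain of [v] frees [a] at [v], while [u], being off the chain, still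
    misses [a]. A new edge between them can then take [a]. *)
Lemma kempe_swap : exists col' : V -> V -> C,
  [/\ forall x y, col' x y = col' y x, proper E col',
      forall y, E u y -> col' u y != a & forall y, E v y -> col' v y != a].
Proof.
pose col' x y := if chain x || chain y then swap (col x y) else col x y.
(* Either end decides: edges coloured [a] or [b] do not leave the chain, and [swap] fixes every
   other colour. *)
have inC x y : E x y -> col' x y = if chain x then swap (col x y) else col x y.
  move=> Exy; rewrite /col'; have := chain_edge Exy.
  case: (chain x) => //=; case: (chain y) => // h.
  by rewrite /swap; move: h; case: eqP => [_ /(_ isT)//|_]; case: eqP => [_ /(_ isT)|].
exists col'; split.
- by move=> x y; rewrite /col' orbC symcol.
- move=> x y z Exy Exz; rewrite !inC //; case: ifP => _ => [/swap_inj|]; exact: pcol.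
- by move=> y Euy; rewrite inC // (negPf chainNu) ua.
- move=> y Evy; rewrite inC // /chain connect0 /swap.
  have cb := vb Evy; case: (eqVneq (col v y) a) => [ca|ca]; last by rewrite (negPf cb).
  by rewrite -ca eq_sym.
Qed.

End Kempe.

(** * König's edge colouring theorem and the lower bound *)

Lemma subrel_deg (V : finType) (E E' : rel V) x : subrel E' E -> deg E' x <= deg E x.
Proof. by move=> sE; apply/subset_leq_card/subsetP => y; rewrite !inE; exact: sE. Qed.

(** Induction on the number of edges: once [uv] is removed both ends miss a colour, and a Kempe swap
    lets them miss the same one, which is given to [uv]. *)
Lemma konig_edge_coloring (V C : finType) (E : rel V) (c0 : C) :
  symmetric E -> bipartite E -> (forall x, deg E x <= #|C|) ->
  exists2 col : V -> V -> C, forall x y, col x y = col y x & proper E col.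
Proof.
move=> + [part].
have [n] := ubnP #|[set e : V * V | E e.1 e.2]|.
elim: n E => // n IHn E ltEn symE bipE degE.
have [/existsP[u /existsP[v Euv]]|noE] := boolP [exists u, exists v, E u v]; last first.
  exists (fun _ _ => c0) => // x y z Exy; case/negP: noE.
  by apply/existsP; exists x; apply/existsP; exists y.
have puv := bipE _ _ Euv.
have neuv : u != v by apply: contraNneq puv => ->.
pose E' x y := E x y && ~~ (((x == u) && (y == v)) || ((x == v) && (y == u))).
have sE : subrel E' E by move=> x y /andP[].
have degE' x y : E x y -> ~~ E' x y -> deg E' x < deg E x.
  move=> Exy nE'; apply: proper_card; apply/properP; split.
    by apply/subsetP => z; rewrite !inE; exact: sE.
  by exists y; rewrite inE.
have nE'uv : ~~ E' u v by rewrite /E' !eqxx andbF.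
have nE'vu : ~~ E' v u by rewrite /E' !eqxx orbT andbF.
have Evu : E v u by rewrite symE.
have symE' : symmetric E'.
  by move=> x y; rewrite /E' symE orbC; congr (_ && ~~ (_ || _)); rewrite andbC.
have bipE' x y : E' x y -> part x != part y by move/sE; exact: bipE.
have [|x|col symcol pcol] := IHn E' _ symE' bipE'.
- apply: (@leq_trans #|[set e | E e.1 e.2]|) => //; apply: proper_card; apply/properP; split.
    by apply/subsetP => e; rewrite !inE; exact: sE.
  by exists (u, v); rewrite inE.
- exact: leq_trans (subrel_deg _ sE) (degE x).
have [a ua] := missing_color col (leq_trans (degE' _ _ Euv nE'uv) (degE u)).
have [b vb] := missing_color col (leq_trans (degE' _ _ Evu nE'vu) (degE v)).
have [col' [symcol' pcol' ua' va']] :=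
  kempe_swap symE' bipE' symcol pcol puv ua vb.
pose isuv x y := ((x == u) && (y == v)) || ((x == v) && (y == u)).
have isuvC x y : isuv x y = isuv y x.
  by rewrite /isuv; case: (x == u) (x == v) (y == u) (y == v) => [] [] [] [].
exists (fun x y => if isuv x y then a else col' x y) => [x y|x y z Exy Exz].
  by rewrite isuvC symcol'.
have aE t t' : (t == u) || (t == v) -> E' t t' -> col' t t' != a.
  by case/orP => /eqP ->; [exact: ua'|exact: va'].
have isuvP t t' : isuv t t' -> (t == u) || (t == v).
  by case/orP => /andP[-> _]; rewrite ?orbT.
case: ifP => iy; case: ifP => iz.
- move=> _; case/orP: iy => /andP[/eqP xe /eqP ->]; case/orP: iz => /andP[/eqP xe' /eqP ->] //;
    by move: neuv; rewrite -xe -xe' eqxx.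
- move/esym/eqP; rewrite (negPf (aE _ _ (isuvP _ _ iy) _)) //.
  by rewrite /E' Exz -/(isuv x z) iz.
- move/eqP; rewrite (negPf (aE _ _ (isuvP _ _ iz) _)) //.
  by rewrite /E' Exy -/(isuv x y) iy.
- by apply: pcol'; rewrite /E' ?Exy ?Exz -/(isuv _ _) ?iy ?iz.
Qed.

Lemma brDelta_lower (VT : finType) (ET : rel VT) (s k : nat) (v0 : VT) :
  1 <= s -> 2 <= k -> deg ET v0 = k ->
  forall (VH : finType) (EH : rel VH),
    simple_graph EH -> bipartite EH -> arrows EH s ET -> s * (k - 1) + 1 <= maxdeg EH.
Proof.
move=> s1 k2 dv0 VH EH [symH _] bipH arrH; rewrite addn1 ltnNge; apply/negP => leD.
have q0 : 0 < k - 1 by lia.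
have D0 : 0 < s * (k - 1) by rewrite muln_gt0 s1.
have [|x|col symcol pcol] := konig_edge_coloring (Ordinal D0) symH.
- exact: bipH.
- by rewrite card_ord; apply: leq_trans leD; exact: leq_bigmax.
(* The quotient by [k - 1] is the merged colour. *)
have ltc x y : col x y %/ (k - 1) < s by rewrite ltn_divLR // ltn_ord.
have [|i [f [injf fE]]] := arrH (fun x y => Ordinal (ltc x y)).
  by move=> x y; apply: val_inj; rewrite /= symcol.
(* Remainders separate proper colours with equal quotient, so the [k] neighbours of [v0] would
   inject into [k - 1] values. *)
pose h u : 'I_(k - 1) := Ordinal (ltn_pmod (col (f v0) (f u)) q0).
have injh : {in [set u | ET v0 u] &, injective h}.
  move=> u w; rewrite !inE => /fE[Eu /(congr1 val)/= cu] /fE[Ew /(congr1 val)/= cw].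
  move/(congr1 val) => /= huw; apply: injf; apply: (pcol (f v0)) => //.
  by apply: val_inj; rewrite /= (divn_eq (col (f v0) (f u)) (k - 1)) cu huw -cw -divn_eq.
have := card_in_imset injh; rewrite -/(deg ET v0) dv0 => card_h.
have := max_card (mem (h @: [set u | ET v0 u])); rewrite card_h card_ord; lia.
Qed.

(** * A regular bipartite graph of large girth *)

Section WordGraph.
Variables (r : nat) (I : finType).

Definition reduced (w : seq I) := sorted (fun i j => i != j) w.

(** Fixing non-reduced words, and words of full length not starting with [i], makes this an
    involution on all words of length at most [r]. *)
Definition toggle (i : I) (w : seq I) : seq I :=
  if ~~ reduced w then w
  else if ohead w == Some i then behead w
  else if size w < r then i :: w else w.

Lemma toggle_size i w : size w <= r -> size (toggle i w) <= r.
Proof.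
move=> ler; rewrite /toggle; case: ifP => // _; case: ifP => _; last by case: ifP.
by rewrite size_behead; lia.
Qed.

Lemma toggle_push i w :
  reduced w -> ohead w != Some i -> size w < r -> toggle i w = i :: w.
Proof. by rewrite /toggle => -> /negPf-> ->. Qed.

Lemma reduced_cons i w : reduced (i :: w) = (ohead w != Some i) && reduced w.
Proof. by case: w => //= j w; rewrite eq_sym. Qed.

Lemma toggleK i w : size w <= r -> toggle i (toggle i w) = w.
Proof.
move=> ler; have [rw|nrw] := boolP (reduced w); last by rewrite /toggle !nrw.
have [hw|hw] := boolP (ohead w == Some i).
  case: w hw rw ler => // j w /eqP[->]; rewrite reduced_cons => /andP[hw rw] ler.
  by rewrite {2}/toggle reduced_cons hw rw /= eqxx toggle_push.
have [ltr|ger] := ltnP (size w) r; last first.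
  by rewrite /toggle rw (negPf hw) ltnNge ger /= rw (negPf hw) ltnNge ger.
by rewrite (toggle_push rw hw ltr) /toggle reduced_cons hw rw /= eqxx.
Qed.

Definition toggle_bseq (i : I) (w : r.-bseq I) : r.-bseq I := Bseq (toggle_size i (size_bseq w)).

Lemma toggle_bseqK i : involutive (toggle_bseq i).
Proof. by move=> w; apply: val_inj; rewrite /= toggleK ?size_bseq. Qed.

Definition gen (i : I) : {perm r.-bseq I} := perm (inv_inj (toggle_bseqK i)).

Lemma genK i : (gen i * gen i)%g = 1%g.
Proof. by apply/permP => w; rewrite permM perm1 !permE toggle_bseqK. Qed.

(** Products of permutations apply the left factor first, so crossing an edge applies one more
    toggle to the image of a fixed word. *)
Definition cover_adj : rel ({perm r.-bseq I} * bool) :=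
  fun x y => (x.2 != y.2) && [exists i, y.1 == (x.1 * gen i)%g].

Lemma cover_adj_sym : symmetric cover_adj.
Proof.
suff imp x y : cover_adj x y -> cover_adj y x by move=> x y; apply/idP/idP; exact: imp.
case/andP=> xy /existsP[i /eqP yi]; rewrite /cover_adj eq_sym xy /=.
by apply/existsP; exists i; rewrite yi -mulgA genK mulg1.
Qed.

Lemma cover_adj_simple : simple_graph cover_adj.
Proof. by split; [exact: cover_adj_sym | move=> x; rewrite /cover_adj eqxx]. Qed.

Lemma cover_adj_bipartite : bipartite cover_adj.
Proof. by exists snd => x y /andP[]. Qed.

Lemma gen_inj : 0 < r -> injective gen.
Proof.
(* The image of the empty word is the one-letter word [i], which recovers the generator. *)
move=> r0 i j /(congr1 (fun p : {perm _} => val (p [bseq]))).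
by rewrite !permE /= /toggle /= r0 => -[].
Qed.

Lemma cover_adj_deg x : 0 < r -> deg cover_adj x = #|I|.
Proof.
move=> r0; pose g i := ((x.1 * gen i)%g, ~~ x.2).
have injg : injective g by move=> i j [/mulgI]; exact: gen_inj.
rewrite -cardsT -(card_imset _ injg); apply: eq_card => -[q b]; rewrite !inE.
apply/andP/imsetP => /= [[xb /existsP[i /eqP->]]|[i _ [-> ->]]].
  by exists i; rewrite /g ?inE //; case: x.2 b xb => [] [].
by split; [case: x.2 | apply/existsP; exists i].
Qed.

(* Evaluating the permutations along a cycle at the preimage of the empty word
   under the first one pushes one letter per edge. *)
Lemma cover_adj_girth (c : seq ({perm r.-bseq I} * bool)) :
  3 <= size c -> size c <= r -> uniq c -> ~~ path.cycle cover_adj c.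
Proof.
case: c => // x0 c; set m := size _ => m3 mr uc; apply/negP => /= cyc.
pose P j := nth x0 (x0 :: rcons c x0) j.
have adjP j : j < m -> cover_adj (P j) (P j.+1).
  by move=> jm; apply: (pathP x0 cyc); rewrite size_rcons.
have Pm : P m = x0 by rewrite /P /m /= nth_rcons ltnn eqxx.
have Pnth j : j < m -> P j = nth x0 (x0 :: c) j.
  by case: j => //= j jm; rewrite /P /= nth_rcons ifT.
(* A cycle on at least three vertices never turns back; [j.+2 = m] is the case wrapping around to
   [x0]. *)
have nback j : j.+2 <= m -> P j != P j.+2.
  move=> le_m; have ltjm : j < m by lia.
  rewrite (Pnth _ ltjm); have [jm|ltm] := eqVneq j.+2 m.
    by rewrite jm Pm -[X in _ != X]/(nth x0 (x0 :: c) 0) nth_uniq // -lt0n; lia.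
  have ltSSm : j.+2 < m by lia.
  by rewrite (Pnth _ ltSSm) nth_uniq //; lia.
pose w j : seq I := (P j).1 ((P 0).1^-1 [bseq])%g.
have w0 : w 0 = [::] by rewrite /w permKV.
have wS j i : (P j.+1).1 = ((P j).1 * gen i)%g -> w j.+1 = toggle i (w j).
  by rewrite /w => ->; rewrite permM [gen i _]permE.
(* Toggling the head letter would undo the previous step, against [nback]; so every step pushes, and
   [m <= r] leaves room. *)
have grow j : j < m -> [/\ size (w j) = j, reduced (w j) &
    exists i, (P j.+1).1 = ((P j).1 * gen i)%g /\ ohead (w j) != Some i].
  elim: j => [|j IHj] jm.
    by rewrite w0; case/andP: (adjP _ jm) => _ /existsP[i /eqP Pi]; split=> //; exists i.
  have [sj rj [i [Pi hi]]] := IHj (ltnW jm).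
  have wi : w j.+1 = i :: w j by rewrite (wS _ _ Pi) toggle_push // sj; lia.
  rewrite wi reduced_cons hi /= sj; split=> //.
  case/andP: (adjP _ jm) => b12 /existsP[i' /eqP Pi']; exists i'; split=> //.
  apply: contraNneq (nback j jm) => -[ii']; apply/eqP.
  case/andP: (adjP _ (ltnW jm)) => b01 _.
  rewrite [P j]surjective_pairing [P j.+2]surjective_pairing; congr (_, _).
    by rewrite Pi' -ii' Pi -mulgA genK mulg1.
  by case: (P j).2 (P j.+1).2 (P j.+2).2 b01 b12 => [] [] [].
have lm : m.-1 < m by lia.
have [sl rl [i [Pi hi]]] := grow _ lm.
(* The last step returns to [P 0], where the word is empty, yet it too pushes a letter. *)
have := wS _ _ Pi; rewrite prednK; last by lia.
by rewrite {1}/w Pm permKV toggle_push // sl; lia.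
Qed.

End WordGraph.

(** * Dense vertex subsets *)

Definition deg_in (V : finType) (E : rel V) (S : {set V}) (x : V) :=
  #|[set y in S | E x y]|.

Lemma sum_deg_in_remove (V : finType) (E : rel V) (S : {set V}) (x : V) :
  symmetric E -> irreflexive E -> x \in S ->
  \sum_(y in S) deg_in E S y
    = \sum_(y in S :\ x) deg_in E (S :\ x) y + 2 * deg_in E S x.
Proof.
move=> symE irE xS; rewrite (big_setD1 x) //=.
have degD y : deg_in E S y = E y x + deg_in E (S :\ x) y.
  rewrite /deg_in (cardsD1 x [set z in S | E y z]) !inE xS; congr (_ + _).
  by apply: eq_card => z; rewrite !inE andbA.
under eq_bigr do rewrite degD.
rewrite big_split /= addnC; suff -> : \sum_(i in S :\ x) E i x = deg_in E S x by lia.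
rewrite degD irE add0n /deg_in -sum1_card big_mkcond [RHS]big_mkcond.
by apply: eq_bigr => y _; rewrite inE symE; case: (_ \in _); case: (E x y).
Qed.

(** Take [S] minimal with average inner degree above [q]. Deleting a vertex with at most [q / 2]
    neighbours in [S] lowers the degree sum by at most [q], so the rest would still be dense. *)
Lemma dense_subset (V : finType) (E : rel V) (q : nat) :
  symmetric E -> irreflexive E -> q * #|V| < \sum_x deg E x ->
  exists S : {set V}, [/\ exists2 x, x \in S & q < deg_in E S x &
    forall x, x \in S -> q < 2 * deg_in E S x].
Proof.
move=> symE irE dense.
pose P (S : {set V}) := q * #|S| < \sum_(x in S) deg_in E S x.
have PT : P [set: V].
  rewrite /P cardsT; apply: leq_trans dense _; rewrite [leqRHS]big_mkcond /=.
  apply: leq_sum => x _; rewrite inE; apply: subset_leq_card.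
  by apply/subsetP => y; rewrite !inE.
case: (minset_exists PT) => S /minsetP[PS minS] _; exists S; split.
  apply/exists_inP; apply: contraLR PS; rewrite negb_exists_in => /forall_inP le_q.
  rewrite /P -leqNgt mulnC -sum_nat_const; apply: leq_sum => x xS.
  by rewrite leqNgt le_q.
move=> x xS; rewrite ltnNge; apply/negP => le_q.
suff /minS/(_ (subD1set S x)) eqS : P (S :\ x) by move: xS; rewrite -eqS !inE eqxx.
move: PS; rewrite /P (sum_deg_in_remove symE irE xS) (cardsD1 x S) xS.
lia.
Qed.

(** * Greedy embedding of the tree *)

Lemma restricted_path (V : finType) (E : rel V) (A : {set V}) x y :
  connect (fun a b => [&& a \in A, b \in A & E a b]) x y -> x \in A ->
  exists p, [/\ path E x p, uniq (x :: p), {subset x :: p <= A} & y = last x p].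
Proof.
move=> /connectP[p0 pth ->] xA; case/shortenP: pth => p pth up _.
exists p; split=> //; first by apply: sub_path pth => a b /and3P[].
move=> z; rewrite inE => /predU1P[->//|zp].
elim: p x xA pth {up p0} zp => //= a p IHp x xA /andP[/and3P[_ aA _] pth].
by rewrite inE => /predU1P[->//|]; exact: IHp pth.
Qed.

Section Greedy.
Variables (VT : finType) (ET : rel VT) (VH : finType) (EH F : rel VH) (v0 : VT) (S : {set VH}).
Hypotheses (symT : symmetric ET) (irT : irreflexive ET) (treeT : is_tree ET).
Hypotheses (symH : symmetric EH) (irH : irreflexive EH).
Hypotheses (symF : symmetric F) (FH : subrel F EH).
Hypothesis girthH : forall c : seq VH,
  3 <= size c -> size c <= #|VT| -> uniq c -> ~~ path.cycle EH c.
Hypothesis degS : forall v y, v != v0 -> y \in S -> deg ET v <= deg_in F S y.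

Let linked (A : {set VT}) := connect (fun a b => [&& a \in A, b \in A & ET a b]).

(** The placed part [A] is kept connected, so that a tree path inside [A] is available for closing
    up cycles, both in the tree and in the host. *)
Let inv (A : {set VT}) (f : VT -> VH) :=
  [/\ v0 \in A, {in A &, forall x y, linked A x y}, {in A &, injective f},
      {in A, forall x, f x \in S} & {in A &, forall x y, ET x y -> F (f x) (f y)}].

Let linkedS A w x y : linked A x y -> linked (w |: A) x y.
Proof.
apply: connect_sub => a b /and3P[aA bA Eab]; apply: connect1.
by rewrite !inE aA bA Eab !orbT.
Qed.

Let linked_sym A x y : linked A x y = linked A y x.
Proof.
by apply: sym_connect_sym => a b; rewrite symT andbCA.
Qed.

(** Otherwise a path from [u] to [u'] inside [A] closes up through [w] to a cycle of the tree. *)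
Let unique_parent (A : {set VT}) u u' w :
  {in A &, forall x y, linked A x y} -> u \in A -> u' \in A -> w \notin A ->
  ET u w -> ET u' w -> u' = u.
Proof.
move=> lA uA u'A wA uw u'w; apply/eqP; apply: contraT => neq.
have [p [pth up subp u'p]] := restricted_path (lA _ _ uA u'A) uA.
case: p pth up subp u'p => [|a p] pth up subp u'p.
  by move: neq; rewrite u'p eqxx.
have : ~~ path.cycle ET [:: w, u, a & p].
  by case: treeT => _ [_]; apply; rewrite // cons_uniq up andbT; apply: contra wA; exact: subp.
case/negP; move: pth u'p; rewrite /= rcons_path [ET w u]symT uw => /andP[-> ->] /= <-.
by rewrite u'w.
Qed.

Let extend A f u w : deg ET v0 <= deg_in F S (f v0) ->
  inv A f -> u \in A -> w \notin A -> ET u w ->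
  exists2 f', inv (w |: A) f' & f' v0 = f v0.
Proof.
move=> deg0 [v0A lA injf fS fF] uA wA uw.
(* The root has its own bound at [f v0], which is why the extension must preserve that value. *)
have deg_u : deg ET u <= deg_in F S (f u).
  by have [->//|uv0] := eqVneq u v0; apply: degS => //; exact: fS.
pose used := f @: [set z in A | ET u z].
(* Since [w] is a neighbour of [u] still to be placed, fewer than [deg ET u] vertices are in
   [used]. *)
have /subsetPn[y] : ~~ ([set y in S | F (f u) y] \subset used).
  apply/negP => /subset_leq_card le1.
  have le2 : #|used| <= #|[set z in A | ET u z]| by exact: leq_imset_card.
  have : #|[set z in A | ET u z]| < deg ET u.
    apply: proper_card; apply/properP; split.
      by apply/subsetP => z; rewrite !inE => /andP[].
    by exists w; rewrite !inE ?uw // (negPf wA).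
  by move: le1 deg_u; rewrite -/(deg_in F S (f u)); lia.
rewrite inE => /andP[yS Fuy] yused.
have ynew z : z \in A -> f z != y.
  move=> zA; apply: contraNneq yused => fzy.
  apply/imsetP; exists z; rewrite // inE zA /=; apply: contraT => nuz.
  (* The image of the path from [u] to [z], closed by the edge to [y], is a cycle on at most [#|VT|]
     vertices. Shorter paths give a loop at [f u] or make [z] a neighbour of [u]. *)
  have [p [pth up subp zp]] := restricted_path (lA _ _ uA zA) uA.
  have := girthH (c := map f (u :: p)); rewrite size_map map_inj_in_uniq; last first.
    by move=> a b /subp aA /subp bA; exact: injf.
  have -> : size (u :: p) <= #|VT| by rewrite -(card_uniqP up) max_card.
  rewrite up; case: p pth up subp zp => [|a [|b p]] pth up subp zp.
  - by move: (FH Fuy); rewrite -fzy zp irH.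
  - by move: pth nuz; rewrite /= andbT zp /= => ->.
  move=> /(_ isT isT isT)/negP[].
  have hom : {in A &, {homo f : s t / ET s t >-> EH s t}}.
    by move=> s t sA tA /(fF _ _ sA tA)/FH.
  suff : path EH (f u) (rcons (map f [:: a, b & p]) (f u)) by [].
  rewrite rcons_path last_map -zp fzy symH (FH Fuy) andbT.
  apply: homo_path_in pth; last by apply/allP => t; exact: subp.
  exact: hom.
pose f' z := if z == w then y else f z.
have f'A z : z \in A -> f' z = f z.
  by rewrite /f'; case: eqP => // -> zA; rewrite zA in wA.
have f'w : f' w = y by rewrite /f' eqxx.
have par z : z \in A -> ET z w -> z = u.
  by move=> zA zw; exact: (unique_parent lA uA zA wA uw zw).
have to_u x : x \in w |: A -> linked (w |: A) x u.
  rewrite !inE => /predU1P[->|xA]; last by apply/linkedS/lA.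
  by apply: connect1; rewrite !inE eqxx uA orbT symT.
exists f'; last by rewrite f'A.
split.
- by rewrite !inE v0A orbT.
- by move=> x x' /to_u xu /to_u x'u; apply: connect_trans xu _; rewrite -/(linked _ _ _) linked_sym.
- move=> x x'; rewrite !inE => /predU1P[->|xA] /predU1P[->|x'A] //; rewrite ?f'w ?f'A //.
  + by move/esym/eqP; rewrite (negPf (ynew _ x'A)).
  + by move/eqP; rewrite (negPf (ynew _ xA)).
  + exact: injf.
- by move=> x; rewrite !inE => /predU1P[->|xA]; rewrite ?f'w ?f'A ?fS.
- move=> x x'; rewrite !inE => /predU1P[->|xA] /predU1P[->|x'A]; rewrite ?f'w ?f'A //.
  + by rewrite irT.
  + by rewrite symT => /par-> //; rewrite symF.
  + by move/par->.
  + exact: fF.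
Qed.

Lemma greedy_embedding y0 : y0 \in S -> deg ET v0 <= deg_in F S y0 ->
  exists2 f : VT -> VH, injective f & forall u v, ET u v -> F (f u) (f v).
Proof.
move=> y0S deg0.
suff grow n : n < #|VT| -> exists (A : {set VT}) f, [/\ #|A| = n.+1, inv A f & f v0 = y0].
  have cV : 0 < #|VT| by apply/card_gt0P; exists v0.
  have [|A [f [cA [_ _ injf _ fF] _]]] := grow #|VT|.-1; first by rewrite prednK.
  have AT x : x \in A.
    suff -> : A = [set: VT] by rewrite inE.
    by apply/eqP; rewrite eqEcard subsetT cardsT cA prednK /=.
  by exists f => [x y|u v]; [exact: injf | exact: fF].
elim: n => [|n IHn] ltn.
  exists [set v0], (fun=> y0); rewrite cards1; split=> //; split.
  - exact: set11.
  - by move=> x y /set1P-> /set1P->; exact: connect0.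
  - by move=> x y /set1P-> /set1P->.
  - by [].
  - by move=> x y /set1P-> /set1P->; rewrite irT.
have [A [f [cA invA fv0]]] := IHn (ltnW ltn).
have [/existsP[u /existsP[w /and3P[uA wA uw]]]|noexit] :=
  boolP [exists u, exists w, [&& u \in A, w \notin A & ET u w]]; last first.
  (* If no tree edge leaves [A], connectedness forces [A] to be everything, against its size. *)
  have clA : closed ET (mem A).
    apply: intro_closed => [|u w uw uA]; first exact: sym_connect_sym.
    apply: contraNT noexit => wA.
    apply/existsP; exists u; apply/existsP; exists w.
    by apply/and3P; split; [exact: uA | exact: wA | exact: uw].
  have AT : A = [set: VT].
    apply/setP => x; rewrite inE; case: treeT => _ [conn _].
    by rewrite -(closed_connect clA (conn v0 x)); case: invA => ->.
  by move: ltn; rewrite -cA AT cardsT ltnn.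
have [|f' inv' f'v0] := extend _ invA uA wA uw; first by rewrite fv0.
by exists (w |: A), f'; rewrite cardsU1 wA cA f'v0.
Qed.
End Greedy.

(** * The densest colour and the upper bound *)

Lemma majority_color (V : finType) (E : rel V) (s q : nat) (c : V -> V -> 'I_s) :
  0 < #|V| -> (forall x, deg E x = s * q + 1) ->
  exists i, q * #|V| < \sum_x deg (fun x y => E x y && (c x y == i)) x.
Proof.
move=> V0 degE; apply/existsP; apply: contraT; rewrite negb_exists => /forallP sparse.
(* The same double sum equals [(s * q + 1) * #|V|], because the colours partition the edges at each
   vertex. *)
have : \sum_i \sum_x deg (fun x y => E x y && (c x y == i)) x <= s * (q * #|V|).
  rewrite -[s in leqRHS]card_ord -sum_nat_const; apply: leq_sum => i _.
  by rewrite leqNgt; exact: sparse.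
rewrite exchange_big /= (eq_bigr (fun=> s * q + 1)) => [|x _]; last first.
  rewrite -(degE x) /deg -[RHS]sum1_card (partition_big (c x) predT) //=.
  by apply: eq_bigr => i _; rewrite -sum1_card; apply: eq_bigl => y; rewrite !inE.
rewrite sum_nat_const mulnDr muln1 mulnCA [q * _]mulnC.
by rewrite -[leqRHS]addn0 leq_add2l leqNgt V0.
Qed.

Lemma brDelta_upper (VT : finType) (ET : rel VT) (s k : nat) (v0 : VT) :
  2 <= k -> simple_graph ET -> is_tree ET -> deg ET v0 = k ->
  (forall v, v != v0 -> deg ET v <= (k + 1) %/ 2) ->
  exists (VH : finType) (EH : rel VH),
    simple_graph EH /\ bipartite EH /\ arrows EH s ET /\ maxdeg EH = s * (k - 1) + 1.
Proof.
move=> k2 [symT irT] treeT dv0 dv; set d := s * (k - 1) + 1; pose r := #|VT|.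
have r0 : 0 < r by apply/card_gt0P; exists v0.
pose VH := ({perm r.-bseq 'I_d} * bool)%type.
have degH x : deg (@cover_adj r 'I_d) x = d by rewrite cover_adj_deg // card_ord.
have [symH irH] := cover_adj_simple r 'I_d.
have VH0 : 0 < #|{: VH}| by apply/card_gt0P; exists (1%g, true).
exists VH, (@cover_adj r 'I_d); split; first exact: cover_adj_simple.
split; first exact: cover_adj_bipartite.
split; last first.
  rewrite /maxdeg; under eq_bigr do rewrite degH.
  apply/eqP; rewrite eqn_leq; apply/andP; split; first by apply/bigmax_leqP.
  exact: (leq_bigmax (F := fun=> d) ((1%g, true) : VH)).
move=> c symc.
pose F i x y := cover_adj x y && (c x y == i).
have symF i : symmetric (F i) by move=> x y; rewrite /F symH symc.
have irF i : irreflexive (F i) by move=> x; rewrite /F irH.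
have [i dense] := majority_color c VH0 degH.
have [S [[y0 y0S degy0] degS]] := dense_subset (symF i) (irF i) dense.
have FH : subrel (F i) (@cover_adj r 'I_d) by move=> x y /andP[].
(* With [q = k - 1], the bound [q < 2 * deg_in] rounds up to [(k + 1) %/ 2 <= deg_in]. *)
have degTS v y : v != v0 -> y \in S -> deg ET v <= deg_in (F i) S y.
  by move=> /dv le_v /degS; lia.
have [|f injf fF] := greedy_embedding symT irT treeT symH irH (symF i) FH
  (@cover_adj_girth r 'I_d) degTS y0S; first by rewrite dv0; apply: leq_trans degy0; lia.
by exists i, f; split=> // u v /fF/andP[-> /eqP].
Qed.

Theorem theorem1 (s k : nat) (VT : finType) (ET : rel VT) :
  1 <= s -> 2 <= k ->
  simple_graph ET -> is_tree ET ->
  (exists v0 : VT, deg ET v0 = k /\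
     forall v : VT, v != v0 -> deg ET v <= (k + 1) %/ 2) ->
  is_brDelta ET s (s * (k - 1) + 1).
Proof.
move=> s1 k2 simpleT treeT [v0 [dv0 dv]]; split; first exact: brDelta_upper dv.
exact: brDelta_lower dv0.
Qed.
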